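(* In the game of Philosophers' Phutball played on a board with $12$ rows and $10$ columns, there exists a drawn configuration: a position (placement of the ball and of chaps, together with a specification of which player is to move) from which each of the two players has a strategy guaranteeing that he or she does not lose, so that under optimal play by both players neither player wins.
   Context: Philosophers' Phutball is a two-player game on the grid points of a board with $m$ rows and $n$ columns. At every moment exactly one grid point is occupied by the ball; some other grid points are occupied by chaps (stones). The two players are Alfred and Betty, who move alternately. On a turn a player either (i) places a chap on an unoccupied grid point, or (ii) moves the ball by a sequence of one or more jumps. A single jump is made in one of the eight directions (horizontal, vertical, diagonal): the grid point adjacent to the ball in that direction must be occupied by a chap; the ball moves over the maximal contiguous line of chaps in that direction and lands on the first point beyond it; all chaps jumped over are removed immediately (so they cannot be reused by later jumps of the same turn). A jump may not leave the board across the left or right sidelines (such a jump is illegal); the four corners count as part of the top/bottom goal lines, not the sidelines, so a jump leaving the board across the top row (including diagonally through a top corner) or across the bottom row is allowed and ends the move. After a jump the player may, but need not, continue jumping. Alfred wins if, at the end of a turn, the ball lies in the topmost row or has crossed the topmost row; Betty wins if, at the end of a turn, the ball lies in the bottommost row or has crossed the bottommost row. (Passing through a goal row in the middle of a multi-jump without ending there is not a win.) A play that never ends in a win for either player is a draw. A configuration is drawn if neither player has a winning strategy from it, i.e. each player can ensure he or she never loses. *)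

(* Defs.v *)
From mathcomp Require Import all_boot all_order all_algebra.

Set Implicit Arguments.
Unset Strict Implicit.
Unset Printing Implicit Defensive.

Import Order.TTheory GRing.Theory Num.Theory.
Local Open Scope ring_scope.

(* Row 0 is the topmost row and row m - 1 the bottommost one. *)
Definition point (m n : nat) : Type := ('I_m * 'I_n)%type.

Inductive location (m n : nat) : Type :=
  | At of point m n
  | PastTop
  | PastBottom.
Arguments PastTop {m n}.
Arguments PastBottom {m n}.

Inductive player : Type := Alfred | Betty.

Definition opponent (P : player) : player :=
  match P with Alfred => Betty | Betty => Alfred end.

Record position (m n : nat) : Type := Position {
  ball : location m n;
  chaps : {set 'I_m * 'I_n};
  to_move : player
}.

Definition well_formed (m n : nat) (s : position m n) : bool :=
  match ball s with At p => p \notin chaps s | _ => false end.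

Definition directions : seq (int * int) :=
  [:: (-1, -1); (-1, 0); (-1, 1); (0, -1); (0, 1); (1, -1); (1, 0); (1, 1)].

(* Points of the board are embedded in the plane lattice, so that one can speak
   of points off the board. *)
Definition coords (m n : nat) (p : point m n) : int * int :=
  ((p.1 : nat)%:Z, (p.2 : nat)%:Z).

Definition along (m n : nat) (p : point m n) (d : int * int) (i : nat) :
    int * int :=
  ((coords p).1 + d.1 *+ i, (coords p).2 + d.2 *+ i).

Definition chap_at (m n : nat) (C : {set 'I_m * 'I_n}) (z : int * int) : bool :=
  [exists q in C, coords q == z].

(* A lattice point off the board beside rows 0, ..., m - 1 yields no location:
   jumps across the sidelines are illegal.  Only the row matters for the points
   above and below the board, hence diagonal jumps through a corner are legal. *)
Definition lands (m n : nat) (z : int * int) (l : location m n) : bool :=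
  match l with
  | At q => coords q == z
  | PastTop => z.1 < 0
  | PastBottom => m%:Z <= z.1
  end.

Definition jumped (m n : nat) (p : point m n) (d : int * int) (k : nat) :
    {set 'I_m * 'I_n} :=
  [set q : 'I_m * 'I_n | [exists i : 'I_k, coords q == along p d i.+1]].

(* [k] is the length of the maximal line of chaps jumped over. *)
Definition jump (m n : nat) (p : point m n) (C : {set 'I_m * 'I_n})
    (l : location m n) (C' : {set 'I_m * 'I_n}) : Prop :=
  exists (d : int * int) (k : nat),
    [/\ d \in directions,
        (0 < k)%N /\ (forall i : nat, (0 < i <= k)%N -> chap_at C (along p d i)),
        ~~ chap_at C (along p d k.+1),
        lands (along p d k.+1) l
      & C' = C :\: jumped p d k].

Inductive jumps (m n : nat) :
    point m n -> {set 'I_m * 'I_n} -> location m n -> {set 'I_m * 'I_n} -> Prop :=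
  | jumps_last p C l C' : jump p C l C' -> jumps p C l C'
  | jumps_next p C q C' l C'' :
      jump p C (At q) C' -> jumps q C' l C'' -> jumps p C l C''.

Inductive turn (m n : nat) (s : position m n) : position m n -> Prop :=
  | place_chap q : q \notin chaps s -> ball s <> At q ->
      turn s (Position (ball s) (q |: chaps s) (opponent (to_move s)))
  | move_ball p l C : ball s = At p -> jumps p (chaps s) l C ->
      turn s (Position l C (opponent (to_move s))).

(* Positions are snapshots taken between turns, so these conditions never see
   the intermediate points of a sequence of jumps. *)
Definition won_by (m n : nat) (P : player) (s : position m n) : bool :=
  match P, ball s with
  | Alfred, At p => p.1 == 0%N :> nat
  | Alfred, PastTop => true
  | Alfred, PastBottom => false
  | Betty, At p => p.1.+1 == m
  | Betty, PastTop => false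
  | Betty, PastBottom => true
  end.

Definition over (m n : nat) (s : position m n) : bool :=
  won_by Alfred s || won_by Betty s.

(* Plays are infinite sequences, constant once the game is over.  A position in
   which the game is not over always admits a turn: either some point is
   unoccupied, or the ball can jump over the whole column above it. *)
Definition play (m n : nat) (s : position m n) (w : nat -> position m n) : Prop :=
  w 0%N = s /\
  forall i : nat, if over (w i) then w i.+1 = w i else turn (w i) (w i.+1).

(* A strategy may depend on the whole history of the play, listed in
   chronological order and ending with the current position. *)
Record strategy (m n : nat) (P : player) : Type := Strategy {
  choice_of : seq (position m n) -> position m n;
  choice_legal : forall (h : seq (position m n)) (s : position m n),
    to_move s = P -> ~~ over s -> turn s (choice_of (rcons h s))
}.

Definition follows (m n : nat) (P : player) (sigma : strategy m n P)
    (w : nat -> position m n) : Prop :=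
  forall i : nat, to_move (w i) = P -> ~~ over (w i) ->
    w i.+1 = choice_of sigma (mkseq w i.+1).

Definition winning (m n : nat) (P : player) (sigma : strategy m n P)
    (s : position m n) : Prop :=
  forall w, play s w -> follows sigma w -> exists i, won_by P (w i).

Definition non_losing (m n : nat) (P : player) (sigma : strategy m n P)
    (s : position m n) : Prop :=
  forall w, play s w -> follows sigma w -> forall i, ~~ won_by (opponent P) (w i).

Definition drawn (m n : nat) (s : position m n) : Prop :=
  forall P : player, ~ exists sigma : strategy m n P, winning sigma s.

(* Main.v *)
Require Import Defs.
From mathcomp Require Import all_boot all_order all_algebra.
From mathcomp Require Import zify ring boolp.
Import Defs.

(* The ball alternates between two points on either side of an unoccupied point
   [mid].  When Betty is to move she must place a chap on [mid]: otherwise Alfred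
   places a chap that creates several winning sequences of jumps, which Betty
   cannot all block.  The chap on [mid] creates such a multiple threat for Betty,
   and the only defence of Alfred is to jump over it.  This jump removes it and
   leads to the mirror image of the initial situation.  Hence the two players can
   repeat this cycle forever, and a player who leaves it loses by force; the finitely
   many deviations are checked by computation. *)

Set Implicit Arguments.
Unset Strict Implicit.
Unset Printing Implicit Defensive.

Import Order.TTheory GRing.Theory Num.Theory.
Local Open Scope ring_scope.

(** * Strategies from invariants *)

Lemma opponentK : involutive opponent.
Proof. by case. Qed.

(** A [strategy] must name a legal turn at every unfinished position where its player moves, even
    where an invariant fails; this provides one. *)
Lemma turn_exists (m n : nat) (s : position m n) :
  ~~ over s -> exists s', turn s s'.
Proof.
case: s => -[p| |] C P //; rewrite /over /= negb_or => /andP[p_row _].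
case: (pickP [pred q | (q \notin C) && (q != p)]) => [q /andP[qC qp]|full].
  eexists; apply: (place_chap (q := q)) => //= -[pq].
  by rewrite pq eqxx in qp.
have memC (q : 'I_m * 'I_n) : q != p -> q \in C.
  by move=> qp; have := full q; rewrite /= qp andbT => /negbFE.
have above : (p.1 : nat)%:Z + (-1) *+ p.1.+1 = -1.
  by rewrite mulNrn -[p.1.+1]addn1 mulrnDr -natz opprD addrA subrr add0r.
eexists; apply: (@move_ball _ _ (Position (At p) C P) p PastTop) => //.
apply: jumps_last; exists (-1, 0), (p.1 : nat); split => //.
- split=> [|i /andP[i_gt0 i_le]]; first by rewrite lt0n.
  have ltm : (p.1 - i < m)%N by apply: leq_ltn_trans (leq_subr _ _) (ltn_ord _).
  apply/exists_inP; exists (Ordinal ltm, p.2 : 'I_n) => /=.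
    apply: memC; apply/eqP => /(congr1 (fun q : 'I_m * 'I_n => (q.1 : nat))) /= eqp.
    by move: (ltn_subrL i p.1); rewrite i_gt0 eqp ltnn lt0n p_row.
  by rewrite /coords /along /= mulNrn mul0rn addr0 natz subzn.
- by apply/negP => /exists_inP[q _ /eqP[]]; rewrite above.
- by rewrite /= above.
Qed.

(** A memoryless strategy suffices: a choice function picks at each position a turn that preserves
    [I], and [I] then holds along every play by induction. *)
Lemma invariant_non_losing (m n : nat) (P : player)
    (I : position m n -> Prop) (s : position m n) :
  (forall t, I t -> ~~ won_by (opponent P) t) ->
  (forall t, I t -> ~~ over t -> to_move t = P -> exists2 t', turn t t' & I t') ->
  (forall t t', I t -> ~~ over t -> to_move t = opponent P -> turn t t' -> I t') ->
  I s -> exists sigma : strategy m n P, non_losing sigma s.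
Proof.
move=> I_safe I_move I_reply Is.
have /choice[f fP] : forall t : position m n, exists t',
    (to_move t = P -> ~~ over t -> turn t t') /\
    (I t -> to_move t = P -> ~~ over t -> I t').
  move=> t; have [[It [Pt Ot]]|nI] := pselect (I t /\ to_move t = P /\ ~~ over t).
    by have [t' tt' It'] := I_move _ It Ot Pt; exists t'.
  have [/turn_exists[t' tt']|Ot] := pselect (~~ over t).
    by exists t'; split=> // It Pt Ot; case: nI.
  by exists t; split=> [_|_ _] /Ot.
have legal (h : seq (position m n)) t :
    to_move t = P -> ~~ over t -> turn t (f (last s (rcons h t))).
  by rewrite last_rcons; apply: (fP t).1.
(* Histories end with the current position, so the default [s] of [last] never matters. *)
exists (@Strategy _ _ P (fun h => f (last s h)) legal) => w [w0 wS] wf.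
suff Iw i : I (w i) by move=> i; apply: I_safe.
elim: i => [|i Ii]; first by rewrite w0.
have := wS i; case: ifP => [_ ->//|/negbT Oi Ti].
have [Pi|nPi] : to_move (w i) = P \/ to_move (w i) = opponent P.
- by case: (to_move (w i)) (P) => -[]; [left|right|right|left].
- rewrite (wf i Pi Oi) /choice_of mkseqS last_rcons.
  exact: (fP (w i)).2.
- exact: I_reply Ti.
Qed.

(** Since strategies read histories, the recursion builds the growing histories [hist], and the play
    consists of their last entries. *)
Lemma play_exists (m n : nat) (alfred : strategy m n Alfred)
    (betty : strategy m n Betty) (s : position m n) :
  exists w, [/\ play s w, follows alfred w & follows betty w].
Proof.
pose choice Q := if Q is Alfred then choice_of alfred else choice_of betty.
have choice_legal h t : ~~ over t -> turn t (choice (to_move t) (rcons h t)).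
  by rewrite /choice; case E: (to_move t) => Ot; apply: choice_legal.
pose next h := let t := last s h in if over t then t else choice (to_move t) h.
pose hist := fix hist i := if i is j.+1 then rcons (hist j) (next (hist j)) else [:: s].
pose w i := last s (hist i).
have histE i : hist i = mkseq w i.+1.
  elim: i => [//|i IH].
  by rewrite mkseqS -IH /w /= last_rcons.
have wS i : w i.+1 = next (hist i) by rewrite /w /= last_rcons.
have follow Q i : to_move (w i) = Q -> ~~ over (w i) ->
    w i.+1 = choice Q (mkseq w i.+1).
  by rewrite wS /next -/(w i) -histE => -> /negPf->.
exists w; split; [split=> // i|exact: follow|exact: follow].
case: ifPn => [Oi|Oi]; first by rewrite wS /next -/(w i) Oi.
rewrite (follow _ i erefl Oi); case: i Oi => [|i] Oi; first exact: (choice_legal [::]).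
by rewrite mkseqS; apply: choice_legal.
Qed.

(** A winning strategy of one player, played against a non-losing strategy of the other, would yield
    a contradictory play. *)
Lemma non_losing_drawn (m n : nat) (s : position m n) :
  (forall P, exists sigma : strategy m n P, non_losing sigma s) -> drawn s.
Proof.
move=> safe P [sigma sigma_wins]; have [tau tau_safe] := safe (opponent P).
have [w [ws ws_sigma ws_tau]] :
    exists w, [/\ play s w, follows sigma w & follows tau w].
  case: P sigma tau {sigma_wins tau_safe} => sigma tau; first exact: play_exists.
  by have [w []] := play_exists tau sigma s; exists w.
have [i win_i] := sigma_wins w ws ws_sigma.
by have := tau_safe w ws ws_tau i; rewrite opponentK win_i.
Qed.

(** * Computing jumps *)

(* The point in row [r] and column [c] is the cell [(r + 1, c + 1)], so that
   the lattice points just off the board have natural coordinates as well. *)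
Definition cell := (nat * nat)%type.
Definition board := seq (seq bool).

Definition chap (b : board) (x : cell) : bool := nth false (nth [::] b x.1) x.2.

Definition put (v : bool) (b : board) (x : cell) : board :=
  set_nth [::] b x.1 (set_nth false (nth [::] b x.1) x.2 v).

Lemma chap_put v b x y : chap (put v b x) y = if y == x then v else chap b y.
Proof.
rewrite /chap nth_set_nth /= -pair_eqE /pair_eq /=.
by case: eqP => [->|//]; rewrite nth_set_nth /=; case: eqP.
Qed.

(** [k.-1] truncates at 0, so a step matches addition in the lattice as long as it starts from
    positive coordinates. *)
Definition shift (e : int) (k : nat) : nat :=
  match e with Posz 0 => k | Posz _ => k.+1 | Negz _ => k.-1 end.

Definition step (d : int * int) (x : cell) : cell := (shift d.1 x.1, shift d.2 x.2).

Definition pad (m n : nat) (p : point m n) : cell := (p.1.+1, p.2.+1).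

Definition emb (x : cell) : int * int := (x.1%:Z - 1, x.2%:Z - 1).

Lemma pad_inj (m n : nat) : injective (@pad m n).
Proof. by move=> [i j] [i' j'] [/val_inj -> /val_inj ->]. Qed.

Lemma emb_pad (m n : nat) (p : point m n) : emb (pad p) = coords p.
Proof. by rewrite /emb /coords /=; congr pair; lia. Qed.

Lemma emb_inj : injective emb.
Proof. by move=> [a b] [a' b'] [/addIr[->] /addIr[->]]. Qed.

Lemma shiftE (e : int) (k : nat) :
  e \in [:: -1; 0; 1] -> (0 < k)%N -> (shift e k)%:Z - 1 = k%:Z - 1 + e.
Proof.
case: k => // k; rewrite !inE => /or3P[]/eqP-> _ /=; first by rewrite intS; ring.
  by rewrite addr0.
by rewrite [in LHS]intS; ring.
Qed.

Lemma emb_step (d : int * int) (x : cell) :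
  d \in directions -> (0 < x.1)%N -> (0 < x.2)%N ->
  emb (step d x) = ((emb x).1 + d.1, (emb x).2 + d.2).
Proof.
move=> dir x1 x2; rewrite /emb /= !shiftE //; move: d dir; exact/allP.
Qed.

(** Ranging over all cells, frame included, it forces [b] to carry no chap off the board, so that
    lines read in [b] stop at the border as well. *)
Definition represents (m n : nat) (b : board) (C : {set 'I_m * 'I_n}) : Prop :=
  forall x : cell, chap b x = chap_at C (emb x).

Lemma chap_at_coords (m n : nat) (C : {set 'I_m * 'I_n}) (q : 'I_m * 'I_n) :
  chap_at C (coords q) = (q \in C).
Proof.
apply/exists_inP/idP => [[q' q'C /eqP]|qC]; last by exists q.
by rewrite -!emb_pad => /emb_inj/pad_inj <-.
Qed.

Lemma represents_inj (m n : nat) (b : board) (C C' : {set 'I_m * 'I_n}) :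
  represents b C -> represents b C' -> C = C'.
Proof.
move=> bC bC'; apply/setP => q.
by rewrite -!chap_at_coords -emb_pad -bC -bC'.
Qed.

Lemma represents_put1 (m n : nat) (b : board) (C : {set 'I_m * 'I_n}) q :
  represents b C -> represents (put true b (pad q)) (q |: C).
Proof.
move=> bC x; rewrite chap_put bC; case: eqP => [->|/eqP xq].
  by rewrite emb_pad chap_at_coords setU11.
apply/exists_inP/exists_inP => -[q' q'C q'x]; exists q' => //.
  by rewrite setU1r.
move: q'C q'x => /setU1P[->|//]; rewrite -emb_pad => /eqP/emb_inj qx.
by rewrite qx eqxx in xq.
Qed.

(* The length of the line of chaps that starts at [x], or [None] if the fuel [f]
   runs out before its end. *)
Fixpoint line (f : nat) (d : int * int) (b : board) (x : cell) : option nat :=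
  if f is f'.+1 then if chap b x then omap succn (line f' d b (step d x)) else Some 0%N
  else None.

Lemma lineP f d b x k : line f d b x = Some k ->
  (forall i, (i < k)%N -> chap b (iter i (step d) x)) /\ ~~ chap b (iter k (step d) x).
Proof.
elim: f x k => [//|f IH] x k /=; case: ifP => [xb|xb [<-]]; last by rewrite /= xb.
case E: line => [j|] //= [<-]; have [chaps_j end_j] := IH _ _ E.
split=> [[|i] // ij|]; rewrite -?iterS iterSr //; exact: chaps_j.
Qed.

Lemma represents_jumped (m n : nat) (b : board) (C : {set 'I_m * 'I_n}) p d k :
  represents b C ->
  (forall i, (i <= k)%N -> emb (iter i (step d) (pad p)) = along p d i) ->
  represents (foldl (put false) b (traject (step d) (step d (pad p)) k))
    (C :\: jumped p d k).
Proof.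
move=> bC embE x.
have chap_foldl s b' : chap (foldl (put false) b' s) x = (x \notin s) && chap b' x.
  elim: s b' => [//|y s IH] b' /=; rewrite IH chap_put inE negb_or.
  by case: (x =P y); rewrite ?andbF ?andFb //= andbT andbC.
rewrite chap_foldl bC; apply/andP/exists_inP.
  move=> [xs /exists_inP[q qC qx]]; exists q; rewrite // inE qC andbT inE.
  apply: contra xs => /existsP[i /eqP qi]; apply/trajectP; exists i => //.
  apply: emb_inj; rewrite -iterSr embE; last exact: ltn_ord.
  by rewrite -qi (eqP qx).
move=> [q /setDP[qC]]; rewrite inE => nq qx; split; last by apply/exists_inP; exists q.
apply: contra nq => /trajectP[i ik xE]; apply/existsP; exists (Ordinal ik).
by rewrite (eqP qx) xE -iterSr embE.
Qed.

(** Each point before the last is the start or a chap, hence on the board with positive padded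
    coordinates, so the next step does not truncate. This reaches one point beyond the line, the
    landing point. *)
Lemma emb_iter (m n : nat) (C : {set 'I_m * 'I_n}) (p : point m n) d k :
  d \in directions ->
  (forall i, (0 < i <= k)%N -> chap_at C (along p d i)) ->
  forall i, (i <= k.+1)%N -> emb (iter i (step d) (pad p)) = along p d i.
Proof.
move=> dir chaps_k; elim=> [_|i IH ik].
  by rewrite /= emb_pad /along !mulr0n !addr0; case: coords.
have ei := IH (ltnW ik).
have [q qi] : exists q : point m n, coords q = along p d i.
  case: i ik {IH} ei => [|i] ik ei; first by exists p; rewrite -ei emb_pad.
  by have /exists_inP[q _ /eqP] := chaps_k i.+1 ik; exists q.
have : iter i (step d) (pad p) = pad q by apply: emb_inj; rewrite ei emb_pad.
rewrite iterS => qE; rewrite emb_step ?qE // emb_pad qi /along /=.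
by rewrite !mulrSr !addrA.
Qed.

Definition located (m n : nat) (l : location m n) (x : cell) : Prop :=
  match l with
  | At q => x = pad q
  | PastTop => x.1 = 0%N
  | PastBottom => (m < x.1)%N
  end.

Lemma lands_located (m n : nat) (l : location m n) (x : cell) :
  lands (emb x) l <-> located l x.
Proof.
case: l => [q||] /=; last 2 first.
- by split; lia.
- by split; lia.
by rewrite -emb_pad; split=> [/eqP/emb_inj|->].
Qed.

(** The line is measured from the neighbour of the ball, so [k.+1] chaps put the landing cell [k.+2]
    steps away. Sidelines are left to [legal]. *)
Definition hop (f : nat) (b : board) (x : cell) (d : int * int) :
    option (cell * board) :=
  if line f d b (step d x) is Some k.+1 then
    Some (iter k.+2 (step d) x,
          foldl (put false) b (traject (step d) (step d x) k.+1))
  else None.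

Lemma jump_of_hop (m n : nat) f b (C : {set 'I_m * 'I_n}) p d x b' l :
  d \in directions -> represents b C -> hop f b (pad p) d = Some (x, b') ->
  located l x -> exists2 C', jump p C l C' & represents b' C'.
Proof.
move=> dir bC; rewrite /hop; case E: line => [[|k]|] // [<- <-] lx.
have [chaps_k end_k] := lineP E.
(* Induction on the length: reading the next cell as a lattice point uses [emb_iter], which needs
   the preceding chaps. *)
have chap_along j : (j <= k.+1)%N ->
    forall i, (0 < i <= j)%N -> chap_at C (along p d i).
  elim: j => [_ [|i]//|j IH jk i /andP[i0]]; rewrite leq_eqVlt => /predU1P[->|ij].
    rewrite -(emb_iter dir (IH (ltnW jk)) (leqnn _)) -bC iterSr; exact: chaps_k.
  by apply: IH; [exact: ltnW|rewrite i0].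
have embE := emb_iter dir (chap_along _ (leqnn _)).
exists (C :\: jumped p d k.+1).
  exists d, k.+1; split=> //.
  - by split=> //; apply: chap_along.
  - by rewrite -embE // -bC iterSr.
  - by rewrite -embE //; apply/lands_located.
by apply: (represents_jumped (k := k.+1) bC) => i ik; apply: embE; apply: leqW.
Qed.

Lemma hop_of_jump (m n : nat) f b (C C' : {set 'I_m * 'I_n}) p l :
  represents b C -> (forall d, d \in directions -> line f d b (step d (pad p))) ->
  jump p C l C' ->
  exists d x b', [/\ d \in directions, hop f b (pad p) d = Some (x, b'),
    located l x & represents b' C'].
Proof.
move=> bC ends [d [k [dir [k0 chaps_k] end_k lk ->]]].
have embE := emb_iter dir chaps_k.
case E: (line f d b (step d (pad p))) (ends d dir) => [j|] // _.
have [chaps_j end_j] := lineP E.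
(* Both are lengths of a maximal line: the shorter one would end at a chap of the longer. *)
have jk : j = k.
  case: (ltngtP j k) => // [jk|kj].
    by rewrite -iterSr bC embE ?ltnS 1?ltnW // chaps_k in end_j.
  by have := chaps_j k kj; rewrite -iterSr bC embE // (negPf end_k).
rewrite {j}jk in E chaps_j end_j *; case: k k0 E {chaps_j end_j} lk end_k chaps_k embE => // k.
move=> _ E lk end_k chaps_k embE.
exists d, (iter k.+2 (step d) (pad p)),
  (foldl (put false) b (traject (step d) (step d (pad p)) k.+1)).
split=> //; first by rewrite /hop E.
  by apply/lands_located; rewrite embE.
by apply: represents_jumped => // i ik; apply: embE; apply: leqW.
Qed.

Local Close Scope ring_scope.

(** * Forced wins *)

(** A well-founded game tree: the win comes after finitely many turns on each branch. *)
Inductive forced_win (m n : nat) (P : player) : position m n -> Prop :=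
  | forced_won s : won_by P s -> forced_win P s
  | forced_move s t : ~~ over s ->
      to_move s = P -> turn s t -> forced_win P t -> forced_win P s
  | forced_reply s : ~~ over s -> to_move s = opponent P ->
      (forall t, turn s t -> forced_win P t) -> forced_win P s.

(* Unlike [has] and [all], these stop early under the call-by-value strategy of
   [vm_compute], which evaluates both arguments of [||] and [&&].  For the same
   reason the programs below branch with [if]. *)
Fixpoint any (T : Type) (a : T -> bool) (s : seq T) : bool :=
  if s is x :: s' then if a x then true else any a s' else false.

Fixpoint every (T : Type) (a : T -> bool) (s : seq T) : bool :=
  if s is x :: s' then if a x then every a s' else false else true.

Lemma anyP (T : eqType) (a : T -> bool) (s : seq T) :
  any a s -> exists2 x, x \in s & a x.
Proof.
elim: s => //= y s IH; case: ifP => [ay _|_ /IH[x xs ax]].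
  by exists y; rewrite ?mem_head.
by exists x; rewrite // inE xs orbT.
Qed.

Lemma everyP (T : eqType) (a : T -> bool) (s : seq T) x :
  every a s -> x \in s -> a x.
Proof.
elim: s => //= y s IH; case: ifP => // ay /IH ax.
by rewrite inE => /predU1P[->|].
Qed.

Arguments every : simpl never.

Definition onboard (m n : nat) (x : cell) : bool :=
  (0 < x.1 <= m) && (0 < x.2 <= n).

(** In padded rows, 0 lies past the top and 1 is topmost; [m] is bottommost and larger ones lie past
    the bottom. *)
Definition scored (m : nat) (P : player) (x : cell) : bool :=
  match P with Alfred => x.1 <= 1 | Betty => m <= x.1 end.

(** Past the top or bottom every column is accepted, which covers exits through the corners. *)
Definition legal (m n : nat) (x : cell) : bool :=
  [|| x.1 == 0, m < x.1 | onboard m n x].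

Definition hops (m n : nat) (b : board) (x : cell) : seq (cell * board) :=
  [seq h <- pmap (hop (m + n) b x) directions | legal m n h.1].

Fixpoint wins (m n f : nat) (P : player) (b : board) (x : cell) : bool :=
  if f is f'.+1 then
    let hs := hops m n b x in
    if any (fun h => scored m P h.1) hs then true
    else any (fun h => if onboard m n h.1 then wins m n f' P h.2 h.1 else false) hs
  else false.

(** Unlike [wins], this must miss no sequence: exhausted fuel, including that of [line], makes it
    fail. [F] is tested after every jump, since the turn may end there. *)
Fixpoint all_jumps (m n f : nat) (F : cell -> board -> bool) (b : board) (x : cell) :
    bool :=
  if f is f'.+1 then
    if every (fun d => isSome (line (m + n) d b (step d x))) directions then
      every (fun h => if F h.1 h.2 then
                        if onboard m n h.1 then all_jumps m n f' F h.2 h.1 else true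
                      else false) (hops m n b x)
    else false
  else false.

(** Every jump removes a chap, so [m * n] is enough fuel for any sequence. *)
Definition all_turns (m n : nat) (F : cell -> board -> bool) (b : board) (x : cell) :
    bool :=
  if every (fun y => if chap b y then true else if y == x then true
                     else F x (put true b y))
       [seq (i, j) | i <- iota 1 m, j <- iota 1 n]
  then all_jumps m n (m * n) F b x else false.

(* Sound but incomplete: it only tries to place chaps at the cells of [ts], and
   moves the ball only when this wins at once. *)
Fixpoint forces (m n k : nat) (P : player) (ts : seq cell) (b : board) (x : cell) :
    bool :=
  if wins m n (m * n) P b x then true
  else if k is k'.+1 then
    any (fun t => if onboard m n t then if chap b t then false else
                  if t == x then false else
      all_turns m n (fun y b' => if scored m P y then true
                                 else if scored m (opponent P) y then false
                                 else forces m n k' P ts b' y)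
        (put true b t) x else false) ts
  else false.

(** [h] is the one outcome exempted from refutation: the reply that stays on the cycle. *)
Definition replies (m n k : nat) (P : player) (ts : seq cell) (h : cell * board)
    (b : board) (x : cell) : bool :=
  all_turns m n (fun y b' => if (y, b') == h then true
                             else if scored m P y then true
                             else if scored m (opponent P) y then false
                             else forces m n k P ts b' y) b x.

(** * Soundness of the searches *)

Definition depicts (m n : nat) (s : position m n) (x : cell) (b : board) : Prop :=
  located (ball s) x /\ represents b (chaps s).

Lemma onboardP (m n : nat) (x : cell) :
  reflect (exists p : point m n, x = pad p) (onboard m n x).
Proof.
apply: (iffP idP) => [|[[i j] ->]]; last by rewrite /onboard /= !ltn_ord.
case: x => -[|i] [|j]; rewrite /onboard /= ?andbF // => /andP[im jn].
by exists (Ordinal im, Ordinal jn).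
Qed.

Lemma legalP (m n : nat) (x : cell) :
  legal m n x -> exists l : location m n, located l x.
Proof.
case/or3P => [/eqP x0|mx|/onboardP[p ->]]; [by exists PastTop|by exists PastBottom|].
by exists (At p).
Qed.

Lemma located_legal (m n : nat) (l : location m n) (x : cell) :
  located l x -> legal m n x.
Proof.
case: l => [p ->|/= x0|/= mx]; rewrite /legal; last 2 first.
- by rewrite x0.
- by rewrite mx orbT.
by apply/or3P/Or33/onboardP; exists p.
Qed.

Lemma won_by_scored (m n : nat) (P : player) (s : position m n) x :
  0 < m -> located (ball s) x -> won_by P s = scored m P x.
Proof.
move=> m0; case: s => -[p| |] C Q; rewrite /won_by /=; move=> xE; case: P => /=.
- by rewrite xE ltnS leqn0.
- by rewrite xE eqn_leq (ltn_ord p.1).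
- by rewrite xE.
- by rewrite xE leqNgt m0.
- by rewrite leqNgt (leq_trans _ xE).
- by rewrite ltnW.
Qed.

Lemma overE (m n : nat) (s : position m n) P :
  over s = won_by P s || won_by (opponent P) s.
Proof. by case: P; rewrite // orbC. Qed.

Lemma depicts_inj (m n : nat) (s t : position m n) p x b :
  depicts s x b -> depicts t x b -> ball s = At p -> to_move s = to_move t -> s = t.
Proof.
case: s => l C P; case: t => l' C' P' [/= lx bC] [/= lx' bC'] lp <-.
rewrite (represents_inj bC bC') {bC bC'}; rewrite {}lp /= in lx *; rewrite {}lx in lx'.
congr Position; case: l' lx' => [q /pad_inj->|//|] //=.
by rewrite ltnNge ltn_ord.
Qed.

Lemma hopsP (m n : nat) b (C : {set 'I_m * 'I_n}) p x b' :
  represents b C -> (x, b') \in hops m n b (pad p) ->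
  exists l C', [/\ located l x, jump p C l C' & represents b' C'].
Proof.
move=> bC; rewrite mem_filter => /andP[/legalP[l lx]].
rewrite mem_pmap => /mapP[d dir] /esym hopE.
by have [C' pC' bC'] := jump_of_hop dir bC hopE lx; exists l, C'.
Qed.

Lemma winsP (m n f : nat) P b (C : {set 'I_m * 'I_n}) p :
  0 < m -> represents b C -> wins m n f P b (pad p) ->
  exists l C', jumps p C l C' /\ forall Q, won_by P (Position l C' Q).
Proof.
move=> m0; elim: f b C p => [//|f IH] b C p bC /=; case: ifP => [/anyP[[x b'] h_in sx]|_].
  have [l [C' [lx pC' _]]] := hopsP bC h_in; move=> _; exists l, C'; split=> [|Q].
    exact: jumps_last.
  by rewrite (won_by_scored (s := Position l C' Q) P m0 lx).
case/anyP => -[x b'] h_in /=; case: ifP => // /onboardP[q xq] wq.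
have [l [C' [lx pC' bC']]] := hopsP bC h_in; rewrite {}xq in lx wq.
have {}lq : l = At q.
  case: l lx {pC'} => [q' /pad_inj->//|//|] /=; by rewrite ltnNge ltn_ord.
rewrite {}lq in pC'; have [l' [C'' [jC' wl']]] := IH _ _ _ bC' wq.
by exists l', C''; split=> //; apply: jumps_next pC' jC'.
Qed.

Lemma all_jumpsP (m n f : nat) F b (C C' : {set 'I_m * 'I_n}) p l :
  represents b C -> all_jumps m n f F b (pad p) -> jumps p C l C' ->
  exists x b', [/\ F x b', located l x & represents b' C'].
Proof.
(* One jump yields both what is needed if the turn stops there, [F], and what is needed if it
   continues, the check with less fuel. *)
have hop_ok f' b' (D D' : {set 'I_m * 'I_n}) q l' :
    represents b' D -> all_jumps m n f'.+1 F b' (pad q) -> jump q D l' D' ->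
    exists x c, [/\ F x c, located l' x, represents c D' &
                    onboard m n x -> all_jumps m n f' F c x].
  move=> bD /=; case: ifP => // ends all_hops jD.
  have [d [x [c [dir hE lx cD']]]] :=
    hop_of_jump bD (fun d dir => everyP ends dir) jD.
  have := everyP all_hops (x := (x, c)).
  rewrite mem_filter (located_legal lx) mem_pmap -hE map_f // => /(_ isT) /=.
  case: ifP => // Fx next; exists x, c; split=> // xon.
  by rewrite xon in next.
move=> + + pC'.
elim: pC' f b => {p C l C'} [p C l C' pC'|p C q C' l C'' pC' _ IH] [//|f] b bC jb.
  by have [x [b' [? ? ? _]]] := hop_ok _ _ _ _ _ _ bC jb pC'; exists x, b'.
have [x [b' [_ /= -> bC' /(_ _)next]]] := hop_ok _ _ _ _ _ _ bC jb pC'.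
by apply: IH bC' (next _); apply/onboardP; exists q.
Qed.

Lemma all_turnsP (m n : nat) F (s t : position m n) p x b :
  ball s = At p -> depicts s x b -> all_turns m n F b x -> turn s t ->
  (exists y b', F y b' /\ depicts t y b') /\ to_move t = opponent (to_move s).
Proof.
move=> sp [sx bC]; rewrite sp /= in sx; rewrite {}sx /all_turns.
case: ifP => // places jmps; rewrite -/(is_true _) in places.
case=> [q qC|p' l C'].
  rewrite sp => pq; split=> //; exists (pad p), (put true b (pad q)); split.
    have := everyP places (x := pad q); rewrite bC emb_pad chap_at_coords (negPf qC).
    case: eqP => [/pad_inj qp|_]; first by rewrite qp in pq.
    by apply; apply: allpairs_f; rewrite mem_iota /= add1n ltnS ltn_ord.
  by split=> //=; apply: represents_put1.
rewrite sp => -[<-] pC'; split=> //.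
by have [y [b' [Fy ly bC']]] := all_jumpsP bC jmps pC'; exists y, b'.
Qed.

(** The common core of [forcesP] and [repliesP]: the exempted set [E] is empty in the former and a
    singleton in the latter. Soundness at depth [k] is a hypothesis, which the former supplies by
    induction. *)
Lemma turn_forced_win (m n k : nat) P ts (s t : position m n) p x b
    (E : pred (cell * board)) :
  0 < m ->
  (forall (t : position m n) y b', depicts t y b' -> forces m n k P ts b' y ->
    to_move t = P -> ~~ over t -> forced_win P t) ->
  ball s = At p -> depicts s x b -> to_move s = opponent P ->
  all_turns m n (fun y b' => if E (y, b') then true else if scored m P y then true
    else if scored m (opponent P) y then false else forces m n k P ts b' y) b x ->
  turn s t ->
  (exists y b', E (y, b') /\ depicts t y b') \/ forced_win P t.
Proof.
move=> m0 IH sp sx sP ok st.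
have [[y [b' [+ ty]]] tP] := all_turnsP sp sx ok st.
rewrite sP opponentK in tP; case: ifP => [Ey _|_]; first by left; exists y, b'.
rewrite -!(won_by_scored _ m0 ty.1); case: ifP => [won _|nP].
  by right; apply: forced_won.
case: ifP => // nO fk; right; apply: (IH _ _ _ ty fk tP).
by rewrite (overE _ P) nP nO.
Qed.

Lemma forcesP (m n k : nat) P ts (s : position m n) x b :
  0 < m -> depicts s x b -> forces m n k P ts b x -> to_move s = P -> ~~ over s ->
  forced_win P s.
Proof.
move=> m0; elim: k s x b => [|k IH] s x b sx fk sP Os.
all: have [p sp] : exists p, ball s = At p
  by case: (s) Os => -[p||] C Q //; exists p.
all: move: (sx) => [xp bC]; rewrite sp /= in xp.
all: move: fk => /=; case: ifP => [+ _|_].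
1,3: rewrite xp => /(winsP m0 bC)[l [C' [pC' won]]];
     apply: forced_move (move_ball sp pC') (forced_won (won _)) => //.
  by [].
case/anyP => t _; case: ifP => // /onboardP[q ->{t}].
rewrite bC emb_pad chap_at_coords; case: ifPn => // qC; case: eqP => // qx ok.
pose t := Position (ball s) (q |: chaps s) (opponent (to_move s)).
have st : turn s t.
  by apply: place_chap => //; rewrite sp => -[pq]; rewrite xp pq in qx.
apply: (forced_move Os sP st); apply: forced_reply; [exact: Os|by rewrite /= sP|].
move=> u tu; have tx : depicts t x (put true b (pad q)).
  by split=> //; rewrite ?sp //; apply: represents_put1.
have := turn_forced_win (E := xpred0) m0 IH (s := t) sp tx.
by rewrite /= sP => /(_ _ erefl ok tu)[[y [b' []]]|].
Qed.

Lemma repliesP (m n k : nat) P ts h (s t : position m n) p x b :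
  0 < m -> ball s = At p -> depicts s x b -> to_move s = opponent P ->
  replies m n k P ts h b x -> turn s t ->
  depicts t h.1 h.2 \/ forced_win P t.
Proof.
move=> m0 sp sx sP ok st.
have [||] := turn_forced_win (E := pred1 h) m0 _ sp sx sP ok st.
- by move=> u y b' uy fk; apply: forcesP uy fk.
- by move=> [y [b' [/eqP<- ty]]]; left.
by right.
Qed.

(** * The drawn position *)

(** A condition settled by evaluation that keeps all chaps off the frame, so that [b] comes from a
    set of board points. *)
Definition framed (m n : nat) (b : board) : bool :=
  [&& size b <= m.+1, nth [::] b 0 == [::]
    & all (fun r => (size r <= n.+1) && ~~ nth false r 0) b].

Lemma turn_opponent (m n : nat) (s t : position m n) :
  turn s t -> to_move t = opponent (to_move s).
Proof. by case. Qed.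

Lemma represents_framed (m n : nat) (b : board) :
  framed m n b -> represents b [set q : 'I_m * 'I_n | chap b (pad q)].
Proof.
case/and3P => size_b b0 rows x; apply/idP/exists_inP => [bx|[q]]; last first.
  by rewrite inE -emb_pad => bq /eqP/emb_inj<-.
suff /onboardP[q xq] : onboard m n x.
  by exists q; [rewrite inE -xq|rewrite xq emb_pad].
move: bx; case: x => r c; rewrite /chap /onboard /= => bx.
have rb : r < size b.
  by rewrite ltnNge; apply: contraL bx => /(nth_default [::])->; rewrite nth_nil.
have /andP[size_r r0] := allP rows _ (mem_nth [::] rb).
have cr : c < size (nth [::] b r).
  by rewrite ltnNge; apply: contraL bx => /(nth_default false)->.
have -> : r <= m by rewrite -ltnS (leq_trans rb).
have -> : c <= n by rewrite -ltnS (leq_trans cr).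
rewrite !andbT !lt0n.
apply/andP; split; first by apply: contraL bx => /eqP->; rewrite (eqP b0) nth_nil.
by apply: contraL bx => /eqP->.
Qed.

(* Found by a computer search.  The first nine columns are symmetric about the
   column of [mid], and the last one is full so as to act as a sideline. *)
Definition drawing : seq (seq nat) :=
  [:: [:: 1; 0; 0; 0; 1; 0; 0; 0; 1; 1];
      [:: 1; 0; 0; 1; 1; 1; 0; 0; 1; 1];
      [:: 0; 1; 0; 1; 0; 1; 0; 1; 0; 1];
      [:: 1; 0; 0; 0; 1; 0; 0; 0; 1; 1];
      [:: 1; 1; 0; 0; 0; 0; 0; 1; 1; 1];
      [:: 1; 1; 0; 0; 0; 0; 0; 1; 1; 1];
      [:: 0; 0; 1; 0; 1; 0; 1; 0; 0; 1];
      [:: 1; 0; 1; 1; 1; 1; 1; 0; 1; 1];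
      [:: 1; 1; 1; 0; 1; 0; 1; 1; 1; 1];
      [:: 0; 0; 0; 0; 0; 0; 0; 0; 0; 1];
      [:: 0; 1; 0; 1; 1; 1; 0; 1; 0; 1];
      [:: 1; 0; 1; 1; 1; 1; 1; 0; 1; 1] ].

Definition base : board :=
  [::] :: [seq false :: [seq k == 1 | k <- row] | row <- drawing].

Definition mid : point 12 10 := (@Ordinal 12 4 isT, @Ordinal 10 4 isT).

Definition side (right : bool) : point 12 10 :=
  (@Ordinal 12 4 isT, if right then @Ordinal 10 5 isT else @Ordinal 10 3 isT).

Definition chaps0 : {set 'I_12 * 'I_10} := [set q | chap base (pad q)].

Definition ready (right : bool) : position 12 10 :=
  Position (At (side right)) chaps0 Betty.

Definition pressed (right : bool) : position 12 10 :=
  Position (At (side right)) (mid |: chaps0) Alfred.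

Lemma depicts_ready r : depicts (ready r) (pad (side r)) base.
Proof. by split=> //; apply: represents_framed. Qed.

Lemma depicts_pressed r : depicts (pressed r) (pad (side r)) (put true base (pad mid)).
Proof. by split=> //; apply/represents_put1/(depicts_ready r).2. Qed.

Lemma turn_ready r : turn (ready r) (pressed r).
Proof. by apply: place_chap; rewrite ?inE //; case: r. Qed.

Lemma turn_pressed r : turn (pressed r) (ready (~~ r)).
Proof.
apply: move_ball => //; apply: jumps_last.
(* The fuel 22 is [m + n], as in [hops]. *)
have hopE : hop 22 (put true base (pad mid)) (pad (side r)) (0, if r then -1 else 1)%R
    = Some (pad (side (~~ r)), base) by case: r; vm_compute.
have dir : (0, if r then -1 else 1)%R \in directions by case: (r).
have [C' jC' cC'] := jump_of_hop dir (depicts_pressed r).2 hopE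
  (erefl : located (At (side (~~ r))) _).
by move: jC'; rewrite (represents_inj cC' (depicts_ready r).2).
Qed.

(* The placements that refute the deviations from the cycle, found by search. *)
Definition alfred_points : seq cell := [:: (2, 7); (3, 5); (2, 3); (1, 2); (1, 6)].

Definition betty_points : seq cell := [:: (5, 4); (5, 6)].

Lemma reply_ready r t :
  turn (ready r) t -> t = pressed r \/ forced_win Alfred t.
Proof.
(* Depth 2: Alfred needs at most two placements, each checked against every answer, before a winning
   sequence of jumps. *)
have ok : replies 12 10 2 Alfred alfred_points
    (pad (side r), put true base (pad mid)) base (pad (side r)).
  by case: r; vm_compute.
move=> rt.
have [] := repliesP (P := Alfred) (s := ready r) (isT : 0 < 12) erefl
  (depicts_ready r) erefl ok rt; last by right.
move=> td; left; have tA : to_move (pressed r) = to_move t by rewrite (turn_opponent rt).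
by rewrite (depicts_inj (depicts_pressed r) td erefl tA).
Qed.

Lemma reply_pressed r t :
  turn (pressed r) t -> t = ready (~~ r) \/ forced_win Betty t.
Proof.
(* For Betty one placement is enough, at one of the two points between which the ball alternates:
   [betty_points] lists their padded coordinates. *)
have ok : replies 12 10 1 Betty betty_points
    (pad (side (~~ r)), base) (put true base (pad mid)) (pad (side r)).
  by case: r; vm_compute.
move=> rt.
have [] := repliesP (P := Betty) (s := pressed r) (isT : 0 < 12) erefl
  (depicts_pressed r) erefl ok rt; last by right.
move=> td; left; have tB : to_move (ready (~~ r)) = to_move t by rewrite (turn_opponent rt).
by rewrite (depicts_inj (depicts_ready (~~ r)) td erefl tB).
Qed.

(** On a board with a single row the ball would lie in both goal rows at once, hence [1 < m]. *)
Lemma forced_win_safe (m n : nat) P (s : position m n) :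
  1 < m -> forced_win P s -> ~~ won_by (opponent P) s.
Proof.
move=> m1 [t wt|t t' Ot _ _ _|t Ot _ _]; last 2 first.
- by move: Ot; rewrite (overE _ P) negb_or => /andP[].
- by move: Ot; rewrite (overE _ P) negb_or => /andP[].
move: wt; case: t => -[p| |] C Q; case: P => //= /eqP pE.
- by rewrite /won_by /= pE neq_ltn m1.
- by rewrite /won_by /= -lt0n -ltnS pE.
Qed.

Theorem theorem1 :
  exists s : position 12 10,
    [/\ well_formed s, drawn s
      & forall P : player, exists sigma : strategy 12 10 P, non_losing sigma s].
Proof.
have safe P : exists sigma : strategy 12 10 P, non_losing sigma (ready false).
  (* [P] stays on the cycle until the opponent leaves it, and from then on keeps a forced win. *)
  pose I t := forced_win P t \/ exists r, t = ready r \/ t = pressed r.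
  apply: (invariant_non_losing (I := I)); last by right; exists false; left.
  - move=> t [/forced_win_safe->//|[r [->|->]]]; by case: P {I}; case: r.
  - move=> t [].
      case=> {}t; first by rewrite (overE _ P) => ->.
        by move=> t' _ _ tt' wt' _ _; exists t'; last by left.
      by move=> _ tO _ _; rewrite tO; case: (P).
    move=> [r [->|->]] _ _.
      by exists (pressed r); [apply: turn_ready|right; exists r; right].
    by exists (ready (~~ r)); [apply: turn_pressed|right; exists (~~ r); left].
  - move=> t t' [].
      case=> {}t; first by rewrite (overE _ P) => ->.
        by move=> u _ tP _ _ _; rewrite tP; case: (P).
      by move=> _ _ win_t _ _ /win_t; left.
    (* The opponent of [P] is to move, so [P] is Alfred at [ready] and Betty at [pressed], the
       player who gains from a deviation. *)
    move=> [r [->|->]] _ /(congr1 opponent); rewrite opponentK /= => PE; rewrite /I -PE.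
      by case/reply_ready => [->|]; [right; exists r; right|left].
    by case/reply_pressed => [->|]; [right; exists (~~ r); left|left].
exists (ready false); split=> //; first by rewrite /well_formed /= inE.
exact: non_losing_drawn.
Qed.
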